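(* Let $\mathcal{P}_\Sigma$ be the class of distributions defined in the context, with fixed parameters $\alpha\ge0$, $c_0,r_0,C_0,\beta,L>0$, $\mu_{\max}>\mu_{\min}>0$ and compact $\mathcal{C}\subset\mathbf{R}^d$. Let $\hat\eta_n^*$ be the truncated local polynomial estimator defined in the context with bandwidth $h=n^{-1/(2\beta+d)}$ and kernel $K$. For any $n\ge1$ the excess risk of the plug-in classifier $\hat f_n^*=\mathbb{1}_{\{\hat\eta_n^*\ge1/2\}}$ satisfies $$\sup_{P\in\mathcal{P}_\Sigma}\{\mathbf{E}R(\hat f_n^* )-R(f^* )\}\le C\,n^{-\beta(1+\alpha)/(2\beta+d)},$$ where the constant $C>0$ depends only on $\alpha$, $C_0$, $C_1$ and $C_2$. Here $C_1,C_2>0$ are constants, depending only on $\beta,d,L,c_0,r_0,\mu_{\min},\mu_{\max}$ and $K$, such that for this $h$, all $n\ge1$, $\delta>0$, all $P\in\mathcal{P}_\Sigma$ and $P_X$-almost all $x$, $P^{\otimes n}(|\hat\eta_n^*(x)-\eta(x)|\ge\delta)\le C_1\exp(-C_2n^{2\beta/(2\beta+d)}\delta^2)$.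
   Context: $(X,Y)\sim P$ takes values in $\mathcal{Z}=\mathbf{R}^d\times\{0,1\}$; $P_X$ is the law of $X$; $\eta(x)=P(Y=1\mid X=x)$; the sample $(X_i,Y_i)_{i=1}^n$ is i.i.d. with joint law $P^{\otimes n}$; $\mathbf{E}$ is expectation over the sample. For a decision rule $f:\mathbf{R}^d\to\{0,1\}$, $R(f)=P(Y\ne f(X))$ with $(X,Y)$ independent of the sample; $f^*(x)=\mathbb{1}_{\{\eta(x)\ge1/2\}}$. $\|\cdot\|$ is the Euclidean norm, $\mathcal{B}(x,r)$ the closed Euclidean ball, $\lambda$ the Lebesgue measure, and for a multi-index $s\in\mathbf{N}^d$: $|s|=\sum s_i$, $s!=\prod s_i!$, $x^s=\prod x_i^{s_i}$, $D^s$ the partial derivative. Class $\mathcal{P}_\Sigma$: all probability distributions $P$ on $\mathcal{Z}$ such that (i) (margin assumption) $P_X(0<|\eta(X)-1/2|\le t)\le C_0t^\alpha$ for all $t>0$; (ii) $\eta$ belongs to the Hölder class $\Sigma(\beta,L,\mathbf{R}^d)$: with $\lfloor\beta\rfloor$ the maximal integer strictly less than $\beta$, this is the set of $g:\mathbf{R}^d\to\mathbf{R}$ that are $\lfloor\beta\rfloor$ times continuously differentiable and satisfy $|g(x')-g_x(x')|\le L\|x'-x\|^\beta$ for all $x,x'$, where $g_x(x')=\sum_{|s|\le\lfloor\beta\rfloor}\frac{(x'-x)^s}{s!}D^sg(x)$; (iii) (strong density assumption) $P_X$ is supported on a compact $A\subseteq\mathcal{C}$ that is $(c_0,r_0)$-regular,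 i.e. $\lambda[A\cap\mathcal{B}(x,r)]\ge c_0\lambda[\mathcal{B}(x,r)]$ for all $0<r\le r_0$, $x\in A$, and $P_X$ has a Lebesgue density $\mu$ with $\mu_{\min}\le\mu(x)\le\mu_{\max}$ for $x\in A$ and $\mu(x)=0$ otherwise. Kernel: $K:\mathbf{R}^d\to\mathbf{R}_+$ is a measurable function such that there is $c>0$ with $K(x)\ge c\,\mathbb{1}_{\{\|x\|\le c\}}$ for all $x\in\mathbf{R}^d$; $\int K(u)\,du=1$; $\int(1+\|u\|^{4\beta})K^2(u)\,du<\infty$; $\sup_u(1+\|u\|^{2\beta})K(u)<\infty$. Local polynomial estimator of order $l$ with bandwidth $h>0$ and kernel $K$: $\hat\eta_n^{\mathrm{LP}}(x)=\hat\theta_x(0)$ if $\hat\theta_x$ is the unique polynomial $\theta$ of degree (at most) $l$ on $\mathbf{R}^d$ minimizing $\sum_{i=1}^n[Y_i-\theta(X_i-x)]^2K\big(\frac{X_i-x}{h}\big)$, and $\hat\eta_n^{\mathrm{LP}}(x)=0$ if the minimizer is not unique. Truncated estimator $\hat\eta_n^*$: let $\bar B=(\bar B_{s_1,s_2})_{|s_1|,|s_2|\le\lfloor\beta\rfloor}$ with $\bar B_{s_1,s_2}=\frac1{nh^d}\sum_{i=1}^n\big(\frac{X_i-x}{h}\big)^{s_1+s_2}K\big(\frac{X_i-x}{h}\big)$. If the smallest eigenvalue of $\bar B$ is greater than $(\log n)^{-1}$, then $\hat\eta_n^*(x)$ is the projection onto $[0,1]$ of $\hat\eta_n^{\mathrm{LP}}(x)$,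 where $\hat\eta_n^{\mathrm{LP}}$ is the local polynomial estimator of order $\lfloor\beta\rfloor$ with bandwidth $h$ and kernel $K$; otherwise $\hat\eta_n^*(x)=0$. (For $n=1$, $(\log n)^{-1}=+\infty$.)
   Formalization: The exponential bound characterizing C_1 and C_2 is assumed, not proved: the result holds for any C_1, C_2 > 0 with that bound, since under the stated kernel conditions such constants fail to exist for some heavy-tailed K (e.g. d=1, β=1/4, K proportional to (1+|u|)^(-9/8)). *)

(* Defs.v *)
From HB Require Import structures.
From mathcomp Require Import all_boot all_order all_algebra.
From mathcomp Require Import all_classical all_reals all_analysis.

Set Implicit Arguments.
Unset Strict Implicit.
Unset Printing Implicit Defensive.

Import Order.TTheory GRing.Theory Num.Theory.
Import numFieldNormedType.Exports.

Local Open Scope classical_set_scope.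
Local Open Scope ring_scope.

Lemma sigma_finite_pushforward d1 d2 (T1 : measurableType d1)
    (T2 : measurableType d2) (R : realType) (m : set T1 -> \bar R)
    (f : T1 -> T2) (g : T2 -> T1) :
  sigma_finite setT m -> measurable_fun setT g -> cancel f g ->
  sigma_finite setT (pushforward m f).
Proof.
move=> [F TF Foo] mg fK.
exists (fun i => g @^-1` F i).
  by rewrite -preimage_bigcup -TF preimage_setT.
move=> i; have [mF Fi] := Foo i; split.
  by rewrite -[X in measurable X]setTI; exact: mg.
rewrite /pushforward -comp_preimage.
by rewrite (_ : g \o f = id) //; apply/funext => p /=; exact: fK.
Qed.

Lemma sigma_finite_product_measure1 d1 d2 (T1 : measurableType d1)
    (T2 : measurableType d2) (R : realType)
    (m1 : {sigma_finite_measure set T1 -> \bar R})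
    (m2 : {sigma_finite_measure set T2 -> \bar R}) :
  sigma_finite setT (m1 \x m2)%E.
Proof.
have /sigma_finiteP[F [TF ndF Foo]] := sigma_finiteT m1.
have /sigma_finiteP[G [TG ndG Goo]] := sigma_finiteT m2.
exists (fun n => F n `*` G n).
  rewrite -setXTT TF TG predeqE => -[x y]; split.
    move=> [/= [n _ Fnx] [k _ Gky]]; exists (maxn n k) => //; split.
    - by move: x Fnx; exact/subsetPset/ndF/leq_maxl.
    - by move: y Gky; exact/subsetPset/ndG/leq_maxr.
  by move=> [n _ []/= ? ?]; split; exists n.
move=> k; have [? ?] := Foo k; have [? ?] := Goo k.
split; first exact: measurableX.
by rewrite product_measure1E// lte_mul_pinfty// ge0_fin_numE.
Qed.

(* tuple_measure mu n is the product measure mu^{\otimes n} on n-tuples. *)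
Section tuple_measure.
Context d (T : measurableType d) (R : realType).

Definition cons_pair n (p : T * n.-tuple T) : n.+1.-tuple T :=
  [tuple of p.1 :: p.2].

Lemma measurable_cons_pair n :
  measurable_fun [set: T * n.-tuple T] (@cons_pair n).
Proof. exact: measurable_cons. Qed.

Section cons_measure.
Variables (n : nat) (mu : {sigma_finite_measure set T -> \bar R}).
Variable nu : {sigma_finite_measure set (n.-tuple T) -> \bar R}.

Definition cons_measure : set (n.+1.-tuple T) -> \bar R :=
  pushforward (mu \x nu)%E (@cons_pair n).

HB.instance Definition _ := Measure.copy cons_measure
  (measure_function_pushforward__canonical__measure_function_Measure
     (mu \x nu)%E (@measurable_cons_pair n)).

Let cons_measure_sigma_finite : sigma_finite setT cons_measure.
Proof.
pose u (t : n.+1.-tuple T) : T * n.-tuple T := (thead t, [tuple of behead t]).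
apply: (@sigma_finite_pushforward _ _ _ _ _ _ _ u).
- exact: sigma_finite_product_measure1.
- apply: measurable_fun_pair; first exact: measurable_tnth.
  exact: measurable_behead.
- by case=> x t; congr pair; apply/val_inj.
Qed.

HB.instance Definition _ :=
  Measure_isSigmaFinite.Build _ _ _ cons_measure cons_measure_sigma_finite.

End cons_measure.

Section power.
Variable mu : {sigma_finite_measure set T -> \bar R}.

Fixpoint tuple_measure n : {sigma_finite_measure set (n.-tuple T) -> \bar R} :=
  match n with
  | 0%N => \d_([tuple] : 0.-tuple T)
  | n'.+1 => cons_measure mu (tuple_measure n')
  end.

Lemma tuple_measure_box n (A : 'I_n -> set T) : (forall i, measurable (A i)) ->
  tuple_measure n [set t | forall i, A i (tnth t i)]
  = (\prod_(i < n) mu (A i))%E.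
Proof.
elim: n A => [|n IHn] A mA.
  by rewrite big_ord0 /= diracE mem_set// => -[].
have mbox : measurable [set t : n.-tuple T | forall i, A (lift ord0 i) (tnth t i)].
  rewrite (_ : [set t | _] =
    \bigcap_(i in [set: 'I_n]) ((@tnth n T)^~ i @^-1` A (lift ord0 i))); last first.
    by apply/seteqP; split => t /= At i; [move=> _; exact: At|exact: At].
  apply: fin_bigcap_measurable; first exact: finite_finset.
  by move=> i _; rewrite -[X in measurable X]setTI; exact: measurable_tnth.
rewrite big_ord_recl /= -IHn// /cons_measure /pushforward.
rewrite -product_measure1E//; congr ((_ \x _)%E _).
apply/seteqP; split => -[x t] /=.
  move=> Axt; split; first exact: (Axt ord0).
  by move=> i; have := Axt (lift ord0 i); rewrite tnthS.
move=> [Ax At] i; case: (unliftP ord0 i) => [j ->|->]; last exact: Ax.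
by rewrite tnthS; exact: At.
Qed.

End power.

Section iid.
Variables (n : nat) (P : probability T R).

Definition iid_law : set (n.-tuple T) -> \bar R := tuple_measure P n.

HB.instance Definition _ := Measure.on iid_law.

Let iid_law_setT : iid_law setT = 1%E.
Proof.
transitivity (\prod_(i < n) P setT)%E; last first.
  by rewrite big1// => i _; exact: probability_setT.
rewrite -(@tuple_measure_box P n (fun=> setT))//; congr (tuple_measure _ _ _).
by apply/seteqP; split.
Qed.

HB.instance Definition _ :=
  Measure_isProbability.Build _ _ _ iid_law iid_law_setT.

End iid.
End tuple_measure.

Arguments iid_law {d T R} n P.

(* 'rV[R]_d carries the sigma-algebra generated by the coordinates (the Borel
   one), and lebesgue_rV is the d-fold product of lebesgue_measure. *)
Section euclidean_space.
Context (R : realType) (d : nat).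

Let coord (i : 'I_d) (x : 'rV[R]_d) : R := x 0 i.

Let rV_set0 : g_sigma_preimage coord set0.
Proof. exact: sigma_algebra0. Qed.

Let rV_setC A : g_sigma_preimage coord A -> g_sigma_preimage coord (~` A).
Proof. exact: sigma_algebraC. Qed.

Let rV_bigcup (F : _^nat) : (forall i, g_sigma_preimage coord (F i)) ->
  g_sigma_preimage coord (\bigcup_i (F i)).
Proof. exact: sigma_algebra_bigcup. Qed.

HB.instance Definition _ := @isMeasurable.Build default_measure_display
  'rV[R]_d (g_sigma_preimage coord) rV_set0 rV_setC rV_bigcup.

Definition row_of_tuple (t : d.-tuple (measurableTypeR R)) : 'rV[R]_d :=
  \row_i tnth t i.

Let tuple_of_row (x : 'rV[R]_d) : d.-tuple (measurableTypeR R) :=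
  [tuple x 0 i | i < d].

Lemma measurable_coord (i : 'I_d) :
  measurable_fun setT (fun x : 'rV[R]_d => x 0 i).
Proof.
move=> _ Y mY; rewrite setTI; apply: sub_sigma_algebra => /=.
rewrite -bigcup_seq/=; exists i => /=; first by rewrite mem_index_enum.
by exists Y => //; rewrite setTI.
Qed.

Lemma measurable_row_of_tuple : measurable_fun setT row_of_tuple.
Proof.
move=> _ A mA; rewrite setTI.
suff : g_sigma_preimage coord `<=` [set B | measurable (row_of_tuple @^-1` B)].
  by apply.
apply: smallest_sub.
  split => /=; first by rewrite preimage_set0.
    by move=> B mB; rewrite setTD preimage_setC; exact: measurableC.
  by move=> F mF; rewrite preimage_bigcup; exact: bigcupT_measurable.
move=> B; rewrite -bigcup_seq => -[i _ [C mC <-]] /=.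
rewrite setTI (_ : _ @^-1` _ = (@tnth d (measurableTypeR R))^~ i @^-1` C).
  by rewrite -[X in measurable X]setTI; exact: measurable_tnth.
by apply/seteqP; split => t /=; rewrite /coord mxE.
Qed.

Definition lebesgue_rV : set 'rV[R]_d -> \bar R :=
  pushforward (tuple_measure (@lebesgue_measure R) d) row_of_tuple.

HB.instance Definition _ := Measure.copy lebesgue_rV
  (measure_function_pushforward__canonical__measure_function_Measure
     (tuple_measure (@lebesgue_measure R) d) measurable_row_of_tuple).

Let lebesgue_rV_sigma_finite : sigma_finite setT lebesgue_rV.
Proof.
apply: (@sigma_finite_pushforward _ _ _ _ _ _ _ tuple_of_row).
- exact: sigma_finiteT.
- apply/measurable_fun_tnthP => i.
  have -> : (fun t => tnth t i) \o tuple_of_row = (fun x => x 0 i).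
    by apply/funext => x /=; rewrite tnth_mktuple.
  exact: measurable_coord.
- by move=> t; apply/eq_from_tnth => i; rewrite tnth_mktuple mxE.
Qed.

HB.instance Definition _ :=
  Measure_isSigmaFinite.Build _ _ _ lebesgue_rV lebesgue_rV_sigma_finite.

(* The library's norm on 'rV[R]_d is the sup norm. *)
Definition enorm (x : 'rV[R]_d) : R := Num.sqrt (\sum_i x 0 i ^+ 2).

Definition eball (x : 'rV[R]_d) (r : R) : set 'rV[R]_d :=
  [set y | enorm (y - x) <= r].

End euclidean_space.

Section multi_indices.
Variables (R : realType) (d : nat).
Implicit Types (s : 'I_d -> nat) (g : 'rV[R]_d -> R).

(* The finite type of multi-indices s with |s| <= k; the bound 'I_k.+1 on each
   entry is implied by |s| <= k. *)
Definition multi (k : nat) : predArgType :=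
  {s : {ffun 'I_d -> 'I_k.+1} | (\sum_i s i <= k)%N}.

Definition multi_fun k (s : multi k) : 'I_d -> nat := fun i => val s i.

Definition mfact s : nat := (\prod_i (s i)`!)%N.

Definition mpow (x : 'rV[R]_d) s : R := \prod_i x 0 i ^+ s i.

Definition partial (i : 'I_d) g : 'rV[R]_d -> R :=
  fun x => 'D_(delta_mx 0 i) g x.

Definition mpartial s g : 'rV[R]_d -> R :=
  foldr (fun i f => iter (s i) (partial i) f) g (enum 'I_d).

(* All partial derivatives of order <= k exist and are continuous. *)
Fixpoint cont_diff (k : nat) g : Prop :=
  continuous g /\
  match k with
  | 0%N => True
  | k'.+1 => forall i : 'I_d,
      (forall x, derivable g x (delta_mx 0 i)) /\ cont_diff k' (partial i g)
  end.

End multi_indices.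

Coercion multi_fun : multi >-> Funclass.

(* The greatest integer strictly less than b, for b > 0. *)
Definition sfloor (R : realType) (b : R) : nat := `|Num.ceil b|%N.-1.

Lemma sfloorP (R : realType) (b : R) : 0 < b ->
  (sfloor b)%:R < b <= (sfloor b).+1%:R.
Proof.
move=> b0; have c0 : 0 < Num.ceil b by rewrite ceil_gt0.
have cE : Num.ceil b = (sfloor b).+1%:Z.
  by rewrite /sfloor prednK ?absz_gt0 ?gt_eqF// gtz0_abs.
by have := ceil_itv b; rewrite cE intS addrC addKr.
Qed.

Section hoelder.
Variables (R : realType) (d : nat).

Definition taylor (k : nat) (g : 'rV[R]_d -> R) (x x' : 'rV[R]_d) : R :=
  \sum_(s : multi d k) mpow (x' - x) s / (mfact s)%:R * mpartial s g x.

Definition hoelder_class (beta L : R) (g : 'rV[R]_d -> R) : Prop :=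
  cont_diff (sfloor beta) g /\
  forall x x', `|g x' - taylor (sfloor beta) g x x'|
               <= L * enorm (x' - x) `^ beta.

End hoelder.

Section classification.
Variables (R : realType) (d : nat).
Notation Z := ('rV[R]_d * bool)%type.
Implicit Type P : probability Z R.

Definition marginal P : set 'rV[R]_d -> \bar R := pushforward P fst.

HB.instance Definition _ P := Measure.copy (marginal P)
  (measure_function_pushforward__canonical__measure_function_Measure P
     measurable_fst).

Let marginal_setT P : marginal P setT = 1%E.
Proof. by rewrite /marginal /pushforward preimage_setT probability_setT. Qed.

HB.instance Definition _ P :=
  Measure_isProbability.Build _ _ _ (marginal P) (marginal_setT P).

(* eta is a version of x |-> P(Y = 1 | X = x). *)
Definition regression_function P (eta : 'rV[R]_d -> R) : Prop :=
  (marginal P).-integrable setT (EFin \o eta) /\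
  forall B, measurable B ->
    P (B `*` [set true]) = (\int[marginal P]_(x in B) (eta x)%:E)%E.

Definition margin (alpha C0 : R) P (eta : 'rV[R]_d -> R) : Prop :=
  forall t : R, 0 < t ->
    (marginal P [set x | (0 < `|eta x - 2^-1| <= t)%R]
     <= (C0 * t `^ alpha)%:E)%E.

Definition regular (c0 r0 : R) (A : set 'rV[R]_d) : Prop :=
  forall (r : R) x, 0 < r <= r0 -> A x ->
    (c0%:E * lebesgue_rV (eball x r) <= lebesgue_rV (A `&` eball x r))%E.

Definition density_of P (mu : 'rV[R]_d -> R) : Prop :=
  [/\ measurable_fun setT mu, (forall x, 0 <= mu x) &
      forall B, measurable B ->
        marginal P B = (\int[@lebesgue_rV R d]_(x in B) (mu x)%:E)%E].

Definition strong_density (c0 r0 mumin mumax : R) (Cset : set 'rV[R]_d) P :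
    Prop :=
  exists A : set 'rV[R]_d,
    [/\ compact A, A `<=` Cset, regular c0 r0 A, marginal P (~` A) = 0%E &
        exists mu, [/\ density_of P mu,
          (forall x, A x -> mumin <= mu x <= mumax) &
          (forall x, ~ A x -> mu x = 0)]].

(* P belongs to the class, the version of the regression function satisfying
   the Hoelder condition being eta. *)
Record in_class (alpha C0 beta L c0 r0 mumin mumax : R) (Cset : set 'rV[R]_d)
    P (eta : 'rV[R]_d -> R) : Prop := InClass {
  class_regression : regression_function P eta;
  class_margin : margin alpha C0 P eta;
  class_hoelder : hoelder_class beta L eta;
  class_density : strong_density c0 r0 mumin mumax Cset P }.

Definition risk P (f : 'rV[R]_d -> bool) : \bar R :=
  P [set z | z.2 != f z.1].

Definition plug_in (eta : 'rV[R]_d -> R) : 'rV[R]_d -> bool :=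
  fun x => 2^-1 <= eta x.

Record admissible_kernel (beta : R) (K : 'rV[R]_d -> R) : Prop :=
  AdmissibleKernel {
  kernel_measurable : measurable_fun setT K;
  kernel_ge0 : forall x, 0 <= K x;
  kernel_low : exists2 c : R, 0 < c & forall x, c * (enorm x <= c)%R%:R <= K x;
  kernel_int : (\int[@lebesgue_rV R d]_u (K u)%:E = 1)%E;
  kernel_int2 : (\int[@lebesgue_rV R d]_u
    ((1 + enorm u `^ (4 * beta)) * K u ^+ 2)%:E < +oo)%E;
  kernel_sup : has_ubound (range (fun u => (1 + enorm u `^ (2 * beta)) * K u)) }.

Section estimator.
Variables (n : nat) (h : R) (K : 'rV[R]_d -> R).
Variables (D : n.-tuple Z) (x : 'rV[R]_d).

Let X (i : 'I_n) : 'rV[R]_d := (tnth D i).1.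
Let Y (i : 'I_n) : R := (tnth D i).2%:R.

(* Polynomials of degree <= l are given by their coefficients. *)
Definition mpeval l (a : {ffun multi d l -> R}) (u : 'rV[R]_d) : R :=
  \sum_(s : multi d l) a s * mpow u s.

Definition lp_loss l (a : {ffun multi d l -> R}) : R :=
  \sum_(i < n) (Y i - mpeval a (X i - x)) ^+ 2 * K (h^-1 *: (X i - x)).

Definition lp_minimizers l : set {ffun multi d l -> R} :=
  [set a | forall b : {ffun multi d l -> R}, lp_loss a <= lp_loss b].

Definition lp_estimator l : R :=
  if `[< exists! a, @lp_minimizers l a >]
  then mpeval (xget 0 (@lp_minimizers l)) 0 else 0.

Definition Bbar k : 'M[R]_#|{: multi d k}| :=
  \matrix_(p, q) ((n%:R * h ^+ d)^-1 *
    \sum_(i < n) mpow (h^-1 *: (X i - x))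
                   (fun j => (enum_val p : multi d k) j
                             + (enum_val q : multi d k) j)%N
                 * K (h^-1 *: (X i - x))).

End estimator.

(* The set of eigenvalues is finite, and nonempty for a symmetric matrix of
   positive size such as Bbar. *)
Definition smallest_eigenvalue m (A : 'M[R]_m) : R :=
  inf [set a | eigenvalue A a].

(* The test 1 < n accounts for (log 1)^-1 = +oo, since 0^-1 = 0 here. *)
Definition eta_star (beta h : R) (K : 'rV[R]_d -> R) n (D : n.-tuple Z)
    (x : 'rV[R]_d) : R :=
  if (1 < n)%N && ((ln n%:R)^-1 < smallest_eigenvalue (Bbar h K D x (sfloor beta)))
  then Num.max 0 (Num.min 1 (lp_estimator h K D x (sfloor beta))) else 0.

Definition bandwidth (beta : R) (n : nat) : R :=
  n%:R `^ (- (2 * beta + d%:R)^-1).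

Definition excess_risk (beta : R) (K : 'rV[R]_d -> R) (n : nat) P
    (eta : 'rV[R]_d -> R) : \bar R :=
  (\int[iid_law n P]_D risk P (plug_in (eta_star beta (bandwidth beta n) K D))
   - risk P (plug_in eta))%E.

Definition exp_concentration (alpha C0 beta L c0 r0 mumin mumax : R)
    (Cset : set 'rV[R]_d) (K : 'rV[R]_d -> R) (C1 C2 : R) : Prop :=
  forall (n : nat) (delta : R) P (eta : 'rV[R]_d -> R),
    (1 <= n)%N -> 0 < delta ->
    in_class alpha C0 beta L c0 r0 mumin mumax Cset P eta ->
    {ae marginal P, forall x,
      (iid_law n P
        [set D | (delta <= `|eta_star beta (bandwidth beta n) K D x - eta x|)%R]
       <= (C1 * expR (- C2 * n%:R `^ (2 * beta / (2 * beta + d%:R))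
                      * delta ^+ 2))%:E)%E}.

End classification.

(* Main.v *)
Require Import Defs.
From HB Require Import structures.
From mathcomp Require Import all_boot all_order all_algebra.
From mathcomp Require Import all_classical all_reals all_analysis.
From mathcomp Require Import measurable_realfun ring lra.
Import Order.TTheory GRing.Theory Num.Theory.
Import numFieldNormedType.Exports.
Local Open Scope classical_set_scope.
Local Open Scope ring_scope.

(** The excess risk of a classifier f is the integral of |2 eta - 1| over the
    set where f differs from the Bayes rule f* ([risk_regret]). Averaging over
    the sample and exchanging the integrals, the expected excess risk of a
    plug-in rule is the integral over x of
    |2 eta(x) - 1| times the probability that the rule errs at x
    ([expected_risk]). At such an error the estimator and eta lie on opposite
    sides of 1/2, hence |etahat(x) - eta(x)| >= |eta(x) - 1/2|.

    Put dl = n^(-beta/(2 beta + d)), the scale at which the exponential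
    inequality becomes effective. If |eta(x) - 1/2| lies in
    (2^i dl, 2^(i+1) dl], the probability of an error at x is at most
    C1 exp(- C2 4^i), and below dl it is bounded by 1. By the margin assumption
    the j-th of these dyadic shells has mass at most C0 (2^j dl)^alpha, so its
    contribution is of order dl^(1+alpha) times
    2^(j(1+alpha)) exp(- C2 4^(j-1)). These factors are summable in j with a
    sum that depends on alpha, C1, C2 only ([dyadic_series_bound]), whence the
    bound by a constant times dl^(1+alpha) ([plug_in_rate]).

    The exchange of integrals requires that the truncated estimator be jointly
    measurable in the sample and the point ([measurable_eta_star]), although it
    is defined through an infimum over a spectrum and a minimization problem.
    For the spectrum: a continuous function vanishes somewhere in a compact
    interval as soon as it is arbitrarily small at rational points of the
    interval, so having an eigenvalue below a level is a countable combination
    of measurable conditions on the entries ([measurable_zero_lt]). For the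
    minimization: when the smallest eigenvalue of Bbar is positive, Bbar is
    invertible, hence so is the Gram matrix of the least squares problem, and
    the unique minimizer is given by Cramer's rule, a rational function of the
    data ([lp_estimatorE]). *)

Set Implicit Arguments.
Unset Strict Implicit.
Unset Printing Implicit Defensive.

(** * Spectrum of a real matrix *)

Lemma horner_char_poly (R : comNzRingType) n (A : 'M[R]_n) (a : R) :
  (char_poly A).[a] = \det (a%:M - A).
Proof.
rewrite /char_poly -horner_evalE -det_map_mx; congr (\det _).
apply/matrixP => i j; rewrite !mxE/= horner_evalE hornerD hornerN hornerC.
by rewrite hornerMn hornerX.
Qed.

(** The infimum of a set without infimum is 0 by convention, so a smallest
    eigenvalue above a nonnegative level is a genuine infimum. *)
Lemma has_inf_spectrum (R : realType) n (A : 'M[R]_n) (s : R) :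
  0 <= s -> s < smallest_eigenvalue A -> has_inf [set a | eigenvalue A a].
Proof.
by move=> s0 sA; apply/not_notP => /inf_out E0; move: sA;
  rewrite /smallest_eigenvalue E0 ltNge s0.
Qed.

(** A singular matrix has the eigenvalue 0, and then the infimum of its
    spectrum cannot be positive. *)
Lemma smallest_eigenvalue_unitmx (R : realType) n (A : 'M[R]_n) (s : R) :
  0 <= s -> s < smallest_eigenvalue A -> A \in unitmx.
Proof.
move=> s0 sA; rewrite unitmxE unitfE; apply/eqP => A0.
have E0 : eigenvalue A 0.
  rewrite eigenvalue_root_char; apply/rootP.
  by rewrite horner_char_poly raddf0 sub0r -scaleN1r detZ A0 mulr0.
have := s0; apply/negP; rewrite -ltNge; apply: (lt_le_trans sA).
by apply: ge_inf => //; exact: (has_inf_spectrum s0 sA).2.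
Qed.

(** * Measurability of zeros, inverses and spectra *)

Section measurable_real.
Context d (T : measurableType d) (R : realType).

Lemma measurable_fun_det n (A : T -> 'M[R]_n) :
  (forall i j, measurable_fun setT (fun t => A t i j)) ->
  measurable_fun setT (fun t => \det (A t)).
Proof.
move=> mA; rewrite /determinant; apply: measurable_sum => s.
by apply: measurable_funM => //; apply: measurable_prod.
Qed.

Lemma measurable_fun_adj n (A : T -> 'M[R]_n) i j :
  (forall i j, measurable_fun setT (fun t => A t i j)) ->
  measurable_fun setT (fun t => (\adj (A t)) i j).
Proof.
move=> mA; under eq_fun do rewrite mxE /cofactor.
apply: measurable_funM; first exact: measurable_cst.
apply: measurable_fun_det => k l.
by under eq_fun do rewrite !mxE; exact: mA.
Qed.

(** Inversion is not continuous at 0; off 0 it is x times a real power of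
    x^2, and both expressions vanish at 0. *)
Lemma measurable_fun_inv (f : T -> R) :
  measurable_fun setT f -> measurable_fun setT (fun t => (f t)^-1).
Proof.
move=> mf.
rewrite (_ : (fun t => _) = fun t => f t * ((f t) ^+ 2) `^ (-1)).
  apply: measurable_funM => //.
  apply: (measurableT_comp (measurable_powR _)).
  exact: measurable_funX.
apply/funext => t; rewrite powR_inv1 ?sqr_ge0//.
have [->|ft0] := eqVneq (f t) 0; first by rewrite invr0 mul0r.
by rewrite expr2 invfM mulrA divff ?mul1r.
Qed.

Lemma bigcup_rat_measurable (P : set rat) (F : rat -> set T) :
  (forall q, P q -> measurable (F q)) -> measurable (\bigcup_(q in P) F q).
Proof.
move=> mF; rewrite bigcup_mkcond; apply: bigcupT_measurable_rat => q.
by case: ifPn => // /set_mem; exact: mF.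
Qed.

(** The existential quantifier over the real zero is uncountable. It is
    replaced by: for some rationals p < q < b and all j, some rational r in
    (p, q) has |phi t r| < 1/(j+1). A zero yields this by continuity, and
    conversely |phi t| attains on [p, q] its minimum, which must be 0. *)
Lemma measurable_zero_lt (phi : T -> R -> R) (b : R) :
  (forall a, measurable_fun setT (phi ^~ a)) ->
  (forall t, continuous (phi t)) ->
  measurable [set t | exists2 a, a < b & phi t a = 0].
Proof.
move=> mphi cphi.
rewrite (_ : [set t | _] =
  \bigcup_(p : rat) \bigcup_(q in [set q : rat | ratr q < b])
   \bigcap_(j : nat) \bigcup_(r in [set r : rat | ratr p < (ratr r : R) < ratr q])
     [set t | `|phi t (ratr r)| < j.+1%:R^-1]); last first.
  apply/seteqP; split => t /=.
    move=> [a ab pa0].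
    have /rat_in_itvoo[p] : a - 1 < a by lra.
    rewrite inE/= => /itvP hp.
    have /rat_in_itvoo[q] := ab.
    rewrite inE/= => /itvP hq.
    exists p => //; exists q => /=; first by rewrite hq.
    move=> j _.
    have : \forall x \near a, `|phi t x| < j.+1%:R^-1 /\ ratr p < x < ratr q.
      have j0 : 0 < j.+1%:R^-1 :> R by rewrite invr_gt0.
      near=> x; split.
        rewrite -normrN -sub0r -pa0.
        by near: x; move/cvgrPdist_lt: (cphi t a); apply.
      apply/andP; split; near: x.
        by apply: lt_nbhsr; rewrite hp.
      by apply: lt_nbhsl; rewrite hq.
    move=> /nbhs_ballP[e /= e0 He].
    have /rat_in_itvoo[r] : a < a + e by rewrite ltrDl.
    rewrite inE/= => /itvP hr.
    have [|h1 h2] := He (ratr r); last by exists r.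
    by rewrite /ball/= ltr0_norm ?subr_lt0 ?hr// opprB ltrBlDl hr.
  move=> [p _ [q /= qb Hj]].
  have pq : (ratr p : R) <= ratr q.
    by have [r /= /andP[h1 h2] _] := Hj 0%N I; exact: ltW (lt_trans h1 h2).
  (* The minimum of |phi t| over [p, q] is below every 1/(j+1). *)
  have [|c cpq cmin] := @EVT_min _ (fun x => `|phi t x|) _ _ pq.
    apply: continuous_subspaceT => x.
    by apply: (@continuous_comp _ _ _ (phi t) Num.norm);
       [exact: cphi|exact: norm_continuous].
  exists c; first by move: cpq; rewrite in_itv/= => /andP[_ /le_lt_trans]; exact.
  apply/normr0_eq0/le_anti; rewrite normr_ge0 andbT.
  apply/ler_addgt0Pr => e e0; rewrite add0r.
  have [j je] : exists j : nat, j.+1%:R^-1 < e.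
    exists (Num.truncn e^-1).
    by rewrite invf_plt ?posrE//; apply: truncnS_gt.
  have [r /= /andP[h1 h2] h3] := Hj j I.
  apply: le_trans (ltW (lt_trans h3 je)).
  by apply: cmin; rewrite in_itv/= !ltW.
apply: bigcupT_measurable_rat => p.
apply: bigcup_rat_measurable => q _.
apply: bigcapT_measurable => j.
apply: bigcup_rat_measurable => r _.
rewrite -[X in measurable X]setTI.
apply: (measurable_fun_ltr (f := fun t => `|phi t (ratr r)|)
  (g := cst j.+1%:R^-1)) => //.
exact: measurableT_comp.
Unshelve. all: by end_near. Qed.


(** The smallest eigenvalue exceeds s when the spectrum is nonempty and has
    no point below s + 1/(j+1) for some j; the gap makes the infimum strictly
    larger than s. *)
Lemma measurable_lt_smallest_eigenvalue n (A : T -> 'M[R]_n) (s : R) :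
  0 <= s -> (forall i j, measurable_fun setT (fun t => A t i j)) ->
  measurable [set t | s < smallest_eigenvalue (A t)].
Proof.
move=> s0 mA.
pose Z b := [set t | exists2 a, a < b & (char_poly (A t)).[a] = 0].
have mZ b : measurable (Z b).
  apply: (@measurable_zero_lt (fun t a => (char_poly (A t)).[a])) => [a|t].
    under eq_fun do rewrite horner_char_poly.
    apply: measurable_fun_det => i j.
    under eq_fun do rewrite !mxE.
    by apply: measurable_funB => //; exact: measurable_cst.
  exact: continuous_horner.
(* The first union says that the spectrum is nonempty. *)
rewrite (_ : [set t | _] = (\bigcup_(k : nat) Z k%:R) `&`
  (\bigcup_(j : nat) ~` Z (s + j.+1%:R^-1))); last first.
  apply/seteqP; split => t /=.
    rewrite /smallest_eigenvalue; set E := [set a | _] => sE.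
    have [[a Ea] Elb] := has_inf_spectrum s0 sE.
    split.
      exists (Num.truncn a).+1 => //; exists a; first exact: truncnS_gt.
      by apply/rootP; rewrite -eigenvalue_root_char.
    exists (Num.truncn (inf E - s)^-1) => //= -[c cs c0].
    have Ec : E c by rewrite /E/= eigenvalue_root_char; apply/rootP.
    have : inf E < s + (Num.truncn (inf E - s)^-1).+1%:R^-1.
      by apply: le_lt_trans cs; exact: ge_inf.
    rewrite -ltrBlDl ltNge => /negP; apply; apply: ltW.
    by rewrite invf_plt ?posrE ?subr_gt0//; exact: truncnS_gt.
  move=> [[k _ [a _ a0]] [j _ Hj]]; apply: (@lt_le_trans _ _ (s + j.+1%:R^-1)).
    by rewrite ltrDl invr_gt0.
  apply: lb_le_inf; first by exists a; rewrite /= eigenvalue_root_char; apply/rootP.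
  move=> c; rewrite /= eigenvalue_root_char => /rootP c0.
  by rewrite leNgt; apply/negP => cs; apply: Hj; exists c.
apply: measurableI; apply: bigcupT_measurable => k //.
exact: measurableC.
Qed.

End measurable_real.

(** * Weighted least squares *)

Section least_squares.
Context (R : realFieldType) (n m : nat) (phi : 'I_n -> 'rV[R]_m) (y k : 'I_n -> R).

Definition linform (a : 'rV[R]_m) i := \sum_p a 0 p * phi i 0 p.

Definition sqloss (a : 'rV[R]_m) : R := \sum_i (y i - linform a i) ^+ 2 * k i.

Definition gram : 'M[R]_m := \matrix_(p, q) \sum_i phi i 0 p * phi i 0 q * k i.

Definition moment : 'rV[R]_m := \row_q \sum_i y i * phi i 0 q * k i.

Lemma mulmx_gram (a : 'rV[R]_m) :
  a *m gram = \row_q \sum_i linform a i * phi i 0 q * k i.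
Proof.
apply/rowP => q; rewrite !mxE.
under eq_bigr do rewrite mxE mulr_sumr.
rewrite exchange_big/=; apply: eq_bigr => i _.
by rewrite !mulr_suml; apply: eq_bigr => p _; rewrite !mulrA.
Qed.

(** Pythagoras: under the normal equation the residual of a0 is orthogonal to
    every linear form, so the cross term of the expanded square vanishes. *)
Lemma sqloss_decomposition (a a0 : 'rV[R]_m) : a0 *m gram = moment ->
  sqloss a = sqloss a0 + \sum_i linform (a - a0) i ^+ 2 * k i.
Proof.
move=> a0E.
have lB i : linform a i = linform a0 i + linform (a - a0) i.
  by rewrite -big_split; apply: eq_bigr => p _; rewrite !mxE/=; ring.
have cross : \sum_i (y i - linform a0 i) * linform (a - a0) i * k i = 0.
  transitivity (\sum_q (a - a0) 0 q * (moment - a0 *m gram) 0 q).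
    have residual q : (moment - a0 *m gram) 0 q =
        \sum_i (y i - linform a0 i) * phi i 0 q * k i.
      rewrite mulmx_gram !mxE -sumrB; apply: eq_bigr => i _.
      by rewrite !mulrBl.
    under [RHS]eq_bigr do rewrite residual mulr_sumr.
    rewrite [RHS]exchange_big/=; apply: eq_bigr => i _.
    by rewrite mulr_sumr mulr_suml; apply: eq_bigr => q _; ring.
  by rewrite a0E subrr big1// => q _; rewrite [X in _ * X]mxE mulr0.
transitivity (sqloss a0 + \sum_i linform (a - a0) i ^+ 2 * k i +
  (- 2) * \sum_i (y i - linform a0 i) * linform (a - a0) i * k i); last first.
  by rewrite cross mulr0 addr0.
rewrite mulr_sumr /sqloss -!big_split; apply: eq_bigr => i _.
by rewrite lB/=; ring.
Qed.

Hypothesis k0 : forall i, 0 <= k i.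

Lemma sqloss_minimizer (a0 : 'rV[R]_m) : a0 *m gram = moment ->
  forall a, sqloss a0 <= sqloss a.
Proof.
move=> a0E a; rewrite (sqloss_decomposition a a0E) lerDl.
by apply: sumr_ge0 => i _; rewrite mulr_ge0// sqr_ge0.
Qed.

(** Equality in the Pythagorean identity makes every weighted value of a - a0
    vanish, hence (a - a0) *m gram = 0. *)
Lemma sqloss_unique (a a0 : 'rV[R]_m) : gram \in unitmx -> a0 *m gram = moment ->
  sqloss a <= sqloss a0 -> a = a0.
Proof.
move=> uG a0E; rewrite (sqloss_decomposition a a0E) gerDl => le0.
have pos i : 0 <= linform (a - a0) i ^+ 2 * k i by rewrite mulr_ge0// sqr_ge0.
have z i : linform (a - a0) i ^+ 2 * k i = 0.
  apply/le_anti; rewrite pos andbT; apply: le_trans le0.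
  by rewrite (bigD1 i)//= lerDl sumr_ge0.
apply/eqP; rewrite -subr_eq0 -[_ - _](mulmxK uG) mulmx_gram.
rewrite (_ : \row__ _ = 0) ?mul0mx//; apply/rowP => q; rewrite !mxE big1// => i _.
move/eqP: (z i); rewrite mulf_eq0 sqrf_eq0 => /orP[] /eqP ->.
  by rewrite !mul0r.
by rewrite mulr0.
Qed.

End least_squares.

(** * The local polynomial estimator in closed form *)

Section monomials.
Context (R : realType) (d : nat).
Implicit Types (u : 'rV[R]_d) (s t : 'I_d -> nat).

Lemma mpowZ (c : R) u s : mpow (c *: u) s = c ^+ (\sum_i s i) * mpow u s.
Proof.
rewrite /mpow -prodrXr -big_split; apply: eq_bigr => i _.
by rewrite mxE exprMn.
Qed.

Lemma mpowD u s t : mpow u (fun i => s i + t i)%N = mpow u s * mpow u t.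
Proof. by rewrite /mpow -big_split; apply: eq_bigr => i _; rewrite exprD. Qed.

End monomials.

Section local_polynomial.
Context (R : realType) (d n l : nat) (h : R) (K : 'rV[R]_d -> R).
Notation Z := ('rV[R]_d * bool)%type.
Notation m := #|{: multi d l}|.
Implicit Types (D : n.-tuple Z) (x : 'rV[R]_d).

Definition lp_feature D x (i : 'I_n) : 'rV[R]_m :=
  \row_p mpow ((tnth D i).1 - x) (enum_val p : multi d l).

Definition lp_response D (i : 'I_n) : R := (tnth D i).2%:R.

Definition lp_weight D x (i : 'I_n) : R := K (h^-1 *: ((tnth D i).1 - x)).

Definition lp_gram D x := gram (lp_feature D x) (lp_weight D x).

Definition lp_moment D x :=
  moment (lp_feature D x) (lp_response D) (lp_weight D x).

(** The value at 0 of the least squares polynomial, with its coefficients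
    written by Cramer's rule so that the expression is visibly measurable in
    the data and defined for all samples. *)
Definition lp_solution D x : R :=
  \sum_(s : multi d l) ((\det (lp_gram D x))^-1 *
    (lp_moment D x *m \adj (lp_gram D x)) 0 (enum_rank s)) * mpow (0 : 'rV[R]_d) s.

Definition coef_row (a : {ffun multi d l -> R}) : 'rV[R]_m :=
  \row_p a (enum_val p).

Lemma coef_row_inj : injective coef_row.
Proof.
move=> a b /rowP ab; apply/ffunP => s.
by have := ab (enum_rank s); rewrite !mxE enum_rankK.
Qed.

Lemma lp_lossE D x a : lp_loss h K D x a =
  sqloss (lp_feature D x) (lp_response D) (lp_weight D x) (coef_row a).
Proof.
apply: eq_bigr => i _; congr ((_ - _) ^+ 2 * _).
rewrite /mpeval /linform.
rewrite (reindex (@enum_val (multi d l) predT)) /=; last first.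
  exact/onW_bij/enum_val_bij.
by apply: eq_bigr => p _; rewrite !mxE.
Qed.

Hypothesis K0 : forall u, 0 <= K u.

(** An invertible Gram matrix gives a unique minimizer, so the estimator is not
    in its degenerate branch. *)
Lemma lp_estimatorE D x : lp_gram D x \in unitmx ->
  lp_estimator h K D x l = lp_solution D x.
Proof.
move=> uG; pose v := lp_moment D x *m invmx (lp_gram D x).
pose a0 : {ffun multi d l -> R} := [ffun s => v 0 (enum_rank s)].
have a0v : coef_row a0 = v by apply/rowP => p; rewrite mxE ffunE enum_valK.
have vG : v *m lp_gram D x = lp_moment D x by rewrite mulmxKV.
have w0 i : 0 <= lp_weight D x i by exact: K0.
have a0min : lp_minimizers h K D x a0.
  by move=> b; rewrite !lp_lossE a0v; exact: (sqloss_minimizer w0 vG).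
have a0uniq b : lp_minimizers h K D x b -> b = a0.
  move=> /(_ a0); rewrite !lp_lossE a0v => bmin.
  by apply: coef_row_inj; rewrite a0v; exact: (sqloss_unique w0 uG vG).
rewrite /lp_estimator ifT; last first.
  by apply/asboolP; exists a0; split => // b /a0uniq.
rewrite (a0uniq _ (xgetPex 0 (ex_intro _ a0 a0min))).
apply: eq_bigr => s _; rewrite ffunE /v /invmx uG -scalemxAr mxE.
by [].
Qed.

(** Bbar is built from the rescaled monomials, the Gram matrix from the
    unscaled ones: they differ by n h^d and by the diagonal matrix of the
    powers h^|s| on both sides. *)
Lemma lp_gram_unit D x : 0 < h -> (0 < n)%N ->
  Bbar h K D x l \in unitmx -> lp_gram D x \in unitmx.
Proof.
move=> h0 n0 uB.
pose D1 : 'rV[R]_m := \row_p h ^+ (\sum_i (enum_val p : multi d l) i).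
have uD : diag_mx D1 \in unitmx.
  rewrite unitmxE det_diag unitfE prodf_seq_neq0; apply/allP => p _ /=.
  by rewrite mxE expf_neq0// gt_eqF.
have c0 : n%:R * h ^+ d != 0 by rewrite mulf_neq0// ?pnatr_eq0 ?expf_neq0 ?gt_eqF// -lt0n.
have -> : lp_gram D x = (n%:R * h ^+ d) *: (diag_mx D1 *m Bbar h K D x l *m diag_mx D1).
  rewrite mul_diag_mx mul_mx_diag; apply/matrixP => p q; rewrite !mxE.
  set c := n%:R * _ in c0 *.
  have -> (a S b : R) : c * (a * (c^-1 * S) * b) = a * S * b by field.
  rewrite mulr_sumr mulr_suml.
  apply: eq_bigr => i _; rewrite !mxE mpowD !mpowZ.
  rewrite -/(lp_weight D x i) !exprVn.
  set a := h ^+ _; set b := h ^+ _.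
  have a0 : a != 0 by rewrite expf_neq0// gt_eqF.
  have b0 : b != 0 by rewrite expf_neq0// gt_eqF.
  move: (mpow _ _) (mpow _ _) (lp_weight _ _ _) => u v w.
  by clearbody a b; field; rewrite a0 b0.
by rewrite unitmxZ ?unitfE// !unitmx_mul uD uB.
Qed.

End local_polynomial.

(** * Joint measurability of the truncated estimator *)

Section measurability_of_estimator.
Context (R : realType) (d : nat).
Notation Z := ('rV[R]_d * bool)%type.

Lemma measurable_fun_rV d' (T : measurableType d') (f : T -> 'rV[R]_d) :
  (forall i, measurable_fun setT (fun t => f t 0 i)) -> measurable_fun setT f.
Proof.
move=> mf.
rewrite (_ : f = @row_of_tuple R d \o (fun t => [tuple f t 0 i | i < d])).
  apply: measurableT_comp; first exact: measurable_row_of_tuple.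
  apply/measurable_fun_tnthP => i.
  apply: eq_measurable_fun (mf i) => t _ /=.
  by rewrite tnth_mktuple.
by apply/funext => t; apply/rowP => i; rewrite mxE tnth_mktuple.
Qed.

Context (n l : nat) (h : R) (K : 'rV[R]_d -> R).
Hypothesis mK : measurable_fun setT K.
Notation T := (n.-tuple Z * 'rV[R]_d)%type.

Lemma measurable_sample (i : 'I_n) :
  measurable_fun setT (fun t : T => tnth t.1 i).
Proof. exact: (measurableT_comp (measurable_tnth i) measurable_fst). Qed.

Lemma measurable_displacement (i : 'I_n) (j : 'I_d) :
  measurable_fun setT (fun t : T => ((tnth t.1 i).1 - t.2) 0 j).
Proof.
under eq_fun do rewrite !mxE.
apply: measurable_funB.
  apply: (measurableT_comp (measurable_coord j)).
  exact: (measurableT_comp measurable_fst (measurable_sample i)).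
exact: (measurableT_comp (measurable_coord j) measurable_snd).
Qed.

Lemma measurable_mpow d' (S : measurableType d') (u : S -> 'rV[R]_d) s :
  (forall j, measurable_fun setT (fun t => u t 0 j)) ->
  measurable_fun setT (fun t => mpow (u t) s).
Proof.
by move=> mu; apply: measurable_prod => j _; exact: measurable_funX.
Qed.

Lemma measurable_scaled_displacement (i : 'I_n) (j : 'I_d) :
  measurable_fun setT (fun t : T => (h^-1 *: ((tnth t.1 i).1 - t.2)) 0 j).
Proof.
under eq_fun do rewrite mxE.
by apply: measurable_funM => //; exact: measurable_displacement.
Qed.

Lemma measurable_weight (i : 'I_n) :
  measurable_fun setT (fun t : T => lp_weight h K t.1 t.2 i).
Proof.
apply: (measurableT_comp mK); apply: measurable_fun_rV => j.
exact: measurable_scaled_displacement.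
Qed.

Lemma measurable_Bbar p q :
  measurable_fun setT (fun t : T => Bbar h K t.1 t.2 l p q).
Proof.
under eq_fun do rewrite mxE.
apply: measurable_funM => //; apply: measurable_sum => i.
apply: measurable_funM; last exact: measurable_weight.
by apply: measurable_mpow => j; exact: measurable_scaled_displacement.
Qed.

Lemma measurable_feature i p :
  measurable_fun setT (fun t : T => lp_feature l t.1 t.2 i 0 p).
Proof.
under eq_fun do rewrite mxE.
by apply: measurable_mpow => j; exact: measurable_displacement.
Qed.

Lemma measurable_gram p q :
  measurable_fun setT (fun t : T => lp_gram l h K t.1 t.2 p q).
Proof.
under eq_fun do rewrite mxE.
apply: measurable_sum => i; apply: measurable_funM; last exact: measurable_weight.
by apply: measurable_funM; exact: measurable_feature.
Qed.

Lemma measurable_moment q :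
  measurable_fun setT (fun t : T => lp_moment l h K t.1 t.2 0 q).
Proof.
under eq_fun do rewrite mxE.
apply: measurable_sum => i; apply: measurable_funM; last exact: measurable_weight.
apply: measurable_funM; last exact: measurable_feature.
apply: (@measurableT_comp _ _ _ _ _ _ (fun b : bool => b%:R : R)) => //.
exact: (measurableT_comp measurable_snd (measurable_sample i)).
Qed.

Lemma measurable_lp_solution :
  measurable_fun setT (fun t : T => lp_solution l h K t.1 t.2).
Proof.
apply: measurable_sum => s; apply: measurable_funM => //.
apply: measurable_funM.
  by apply: measurable_fun_inv; apply: measurable_fun_det; exact: measurable_gram.
under eq_fun do rewrite mxE.
apply: measurable_sum => p; apply: measurable_funM; first exact: measurable_moment.
by apply: measurable_fun_adj; exact: measurable_gram.
Qed.

End measurability_of_estimator.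

(** Where the spectral test succeeds, the estimator agrees with the closed
    form, and the test itself is a measurable event. *)
Lemma measurable_eta_star (R : realType) (d n : nat) (beta h : R)
    (K : 'rV[R]_d -> R) : measurable_fun setT K -> (forall u, 0 <= K u) -> 0 < h ->
  measurable_fun setT
    (fun t : n.-tuple ('rV[R]_d * bool) * 'rV[R]_d => eta_star beta h K t.1 t.2).
Proof.
move=> mK K0 h0; set l := sfloor beta.
have [n1|n1] := boolP (1 < n)%N; last first.
  by rewrite /eta_star (negPf n1)/=; exact: measurable_cst.
have s0 : 0 <= (ln n%:R)^-1 :> R.
  by rewrite invr_ge0 ln_ge0// ler1n ltnW.
rewrite (_ : (fun t => _) = fun t =>
  if (ln n%:R)^-1 < smallest_eigenvalue (Bbar h K t.1 t.2 l)
  then Num.max 0 (Num.min 1 (lp_solution l h K t.1 t.2)) else 0); last first.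
  apply/funext => t; rewrite /eta_star n1/=; case: ifPn => // st.
  rewrite lp_estimatorE//; apply: lp_gram_unit => //; first exact: ltnW.
  exact: smallest_eigenvalue_unitmx s0 st.
apply: measurable_fun_ifT => //.
  apply: (measurable_fun_bool true); rewrite setTI.
  by apply: measurable_lt_smallest_eigenvalue => // i j; exact: measurable_Bbar.
apply: measurable_maxr => //; apply: measurable_minr => //.
exact: measurable_lp_solution.
Qed.

(** * Excess risk of a classifier as an integral *)

Section excess_risk_identity.
Context (R : realType) (d : nat) (P : probability ('rV[R]_d * bool)%type R)
  (eta : 'rV[R]_d -> R).
Hypothesis etaP : regression_function P eta.
Implicit Types (f : 'rV[R]_d -> bool).

Let ieta : (marginal P).-integrable setT (EFin \o eta) := etaP.1.

Lemma measurable_regression : measurable_fun setT eta.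
Proof. by apply/measurable_EFinP; exact: (measurable_int _ ieta). Qed.

Lemma measurable_plug_in d' (T : measurableType d') (g : T -> R) :
  measurable_fun setT g -> measurable_fun setT (fun t => 2^-1 <= g t :> R).
Proof. by move=> mg; exact: (measurable_fun_ler (measurable_cst _) mg). Qed.

(** The conditional probability, given X = x, that Y differs from b. *)
Definition pointwise_risk (b : bool) (x : 'rV[R]_d) : R :=
  if b then 1 - eta x else eta x.

Lemma integrable_pointwise_risk f : measurable_fun setT f ->
  (marginal P).-integrable setT (fun x => (pointwise_risk (f x) x)%:E).
Proof.
move=> mf.
apply: (@le_integrable _ _ _ _ _ _ _ (fun x => 1%:E + `|(eta x)%:E|)%E) => //.
- apply/measurable_EFinP; apply: measurable_fun_ifT => //.
    apply: measurable_funB => //; exact: measurable_regression.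
  exact: measurable_regression.
- move=> x _; rewrite lee_fin /pointwise_risk.
  rewrite (ger0_norm (addr_ge0 _ _))//.
  case: (f x); last by rewrite lerDr.
  by rewrite (le_trans (ler_normB _ _))// normr1.
- apply: integrableD => //; last exact: integrable_abse.
  exact: finite_measure_integrable_cst.
Qed.

(** The error event splits into a part where f = 1 and Y = 0 and a part where
    f = 0 and Y = 1; the regression function gives the mass of Y = 1 over any
    measurable set, and the mass of Y = 0 by complement. *)
Lemma riskE f : measurable_fun setT f ->
  risk P f = (\int[marginal P]_x (pointwise_risk (f x) x)%:E)%E.
Proof.
move=> mf; pose F := f @^-1` [set true].
have mF : measurable F by rewrite -[F]setTI; exact: mf.
have mFt : measurable (F `*` [set true]) by exact: measurableX.
have mFf : measurable (F `*` [set false]) by exact: measurableX.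
have PF : (P (F `*` [set false]) = marginal P F - P (F `*` [set true]))%E.
  rewrite /marginal /pushforward.
  rewrite (_ : fst @^-1` F = (F `*` [set false]) `|` (F `*` [set true])); last first.
    apply/seteqP; split => -[x []] /=; try by move=> Fx; [right|left].
    - by move=> Fx; right.
    - by move=> Fx; left.
    - by move=> [[]|[]].
    - by move=> [[]|[]].
  rewrite measureU//; last by apply/seteqP; split => -[x b] //= [[_ ->] [_]].
  by rewrite addeK// fin_num_measure.
rewrite -[in RHS](setUv F) integral_setU//; last 3 first.
- exact: measurableC.
- rewrite setUv; exact: measurable_int (integrable_pointwise_risk mf).
- by apply/disj_setPCl.
rewrite /risk (_ : [set z | _] = (F `*` [set false]) `|` (~` F `*` [set true])); last first.
  apply/seteqP; split => -[x b]; rewrite /F/=.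
    by case: b (f x) => -[] //= _; [right|left].
  by move=> [] [/= fx ->]; [rewrite fx|case: (f x) fx].
rewrite measureU//; [|exact: measurableX (measurableC mF) _|]; last first.
  by apply/seteqP; split => -[x b] //= [[_ ->] [_]].
congr (_ + _)%E.
  transitivity (marginal P F - P (F `*` [set true]))%E; first exact: PF.
  rewrite etaP.2// (_ : marginal P F = \int[marginal P]_(x in F) 1)%E.
    rewrite -integralB//; last 2 first.
    - exact: finite_measure_integrable_cst.
    - exact: integrableS ieta.
    by apply: eq_integral => x; rewrite inE /F/= => fx; rewrite /pointwise_risk fx.
  by rewrite integral_cst// mul1e.
transitivity (\int[marginal P]_(x in ~` F) (eta x)%:E)%E.
  by apply: etaP.2; exact: measurableC.
apply: eq_integral => x; rewrite inE /F/= => /negP.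
by rewrite /pointwise_risk => /negPf ->.
Qed.

Definition regret f x : R := `|2 * eta x - 1| * (f x != plug_in eta x)%:R.

Lemma regret_ge0 f x : 0 <= regret f x.
Proof. by rewrite mulr_ge0. Qed.

Lemma pointwise_risk_regret f x :
  pointwise_risk (f x) x = pointwise_risk (plug_in eta x) x + regret f x.
Proof.
rewrite /regret /pointwise_risk /plug_in.
have [eta2|eta2] := leP 2^-1 (eta x); case: (f x) => /=; rewrite ?mulr0 ?addr0//.
  by rewrite ger0_norm; lra.
by rewrite ltr0_norm; lra.
Qed.

Lemma measurable_plug_in_eta : measurable_fun setT (plug_in eta).
Proof. exact: measurable_plug_in measurable_regression. Qed.

(** The Bayes rule minimizes the conditional error at each point, and the loss
    incurred by the other label is |2 eta - 1|. *)
Lemma risk_regret f : measurable_fun setT f ->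
  risk P f = (risk P (plug_in eta) + \int[marginal P]_x (regret f x)%:E)%E.
Proof.
move=> mf; rewrite !riskE//; last exact: measurable_plug_in_eta.
have ireg : (marginal P).-integrable setT (fun x => (regret f x)%:E).
  have := integrableB measurableT (integrable_pointwise_risk mf)
    (integrable_pointwise_risk measurable_plug_in_eta).
  apply: eq_integrable => // x _.
  by rewrite -EFinB pointwise_risk_regret addrC addKr.
rewrite -integralD//; last exact: integrable_pointwise_risk measurable_plug_in_eta.
by apply: eq_integral => x _; rewrite -EFinD -pointwise_risk_regret.
Qed.

End excess_risk_identity.

(** * The dyadic series *)

Section dyadic_series.
Context (R : realType).

(** Bound for the probability of an error at a point whose distance to the
    level 1/2 lies in the j-th dyadic shell: trivial in the innermost one,
    exponential elsewhere. *)
Definition dyadic_weight (C1 C2 : R) (j : nat) : R :=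
  if j is i.+1 then C1 * expR (- C2 * (2 ^+ i) ^+ 2) else 1.

Lemma dyadic_weight_ge0 (C1 C2 : R) j : 0 <= C1 -> 0 <= dyadic_weight C1 C2 j.
Proof. by move=> C10; case: j => //= j; rewrite mulr_ge0// expR_ge0. Qed.

Lemma expRN_le_power (x : R) k : 0 < x -> expR (- x) <= k.+1`!%:R / x ^+ k.+1.
Proof.
move=> x0; have xk : 0 < x ^+ k.+1 / k.+1`!%:R by rewrite divr_gt0 ?exprn_gt0// ltr0n fact_gt0.
rewrite expRN -invf_div lef_pV2 ?posrE ?expR_gt0//.
by apply: le_trans (expR_ge1Dxn k (ltW x0)); rewrite lerDr.
Qed.

(** The exponential beats any power: exp (- C2 4^i) is at most a constant times
    4^(-i (k+2)), where k + 1 exceeds 1 + alpha. *)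
Lemma dyadic_weight_decay (alpha C1 C2 : R) : 0 <= alpha -> 0 < C1 -> 0 < C2 ->
  exists2 M : R, 0 < M &
    forall j, (2 ^+ j) `^ (1 + alpha) * dyadic_weight C1 C2 j <= M * 2^-1 ^+ j.
Proof.
move=> alpha0 C10 C20.
set k := Num.truncn (1 + alpha).
(* The power k.+2 leaves at least one factor 2^(-i) once 2^(i (k+1)) is absorbed. *)
pose M := C1 * k.+2`!%:R / C2 ^+ k.+2 * 2 ^+ k.+2.
have M0 : 0 < M.
  by rewrite mulr_gt0 ?exprn_gt0// divr_gt0 ?exprn_gt0// mulr_gt0// ltr0n fact_gt0.
exists (1 + M) => [|[|i]]; first by rewrite addr_gt0.
  by rewrite !expr0 powR1 !mulr1 lerDl ltW.
have two0 : 0 < 2 :> R by [].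
set x : R := 2 ^+ i; have x0 : 0 < x by rewrite exprn_gt0.
have x1 : 1 <= x by rewrite exprn_ege1// ler1n.
have -> : 2 ^+ i.+1 = 2 * x :> R by rewrite exprS.
apply: (@le_trans _ _ ((2 * x) ^+ k.+1 *
    (C1 * (k.+2`!%:R / (C2 * x ^+ 2) ^+ k.+2)))).
  apply: ler_pM.
  - exact: powR_ge0.
  - exact: (dyadic_weight_ge0 C2 i.+1 (ltW C10)).
  - rewrite -powR_mulrn; last by rewrite mulr_ge0// ltW.
    apply: ler_powR; first lra.
    by apply: ltW; exact: truncnS_gt.
  - rewrite /dyadic_weight ler_pM2l// mulNr.
    by apply: expRN_le_power; rewrite mulr_gt0// exprn_gt0.
apply: (@le_trans _ _ (M * 2^-1 ^+ i.+1)); last first.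
  by rewrite ler_pM2r ?exprn_gt0 ?invr_gt0// lerDr.
rewrite exprVn [2 ^+ i.+1]exprS -/x /M.
set f := k.+2`!%:R; have f0 : 0 < f by rewrite ltr0n fact_gt0.
set c := C2 ^+ k.+2; have c0 : 0 < c by rewrite exprn_gt0.
set X := x ^+ k.+1; have X1 : 1 <= X by rewrite exprn_ege1.
set t : R := 2 ^+ k.+1; have t0 : 0 < t by rewrite exprn_gt0.
have -> : (C2 * x ^+ 2) ^+ k.+2 = c * (X * x) ^+ 2.
  by rewrite -exprSr exprMn exprAC.
have -> : (2 * x) ^+ k.+1 = t * X by rewrite exprMn.
have -> : 2 ^+ k.+2 = 2 * t :> R by rewrite exprS.
clearbody f c X t x.
have -> : t * X * (C1 * (f / (c * (X * x) ^+ 2))) =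
    C1 * f / c * (2 * t) * (2 * x)^-1 * (X * x)^-1.
  field.
  by rewrite !gt_eqF// (lt_le_trans ltr01).
rewrite ler_piMr//; last by rewrite invf_le1 ?(lt_le_trans ltr01)// mulr_ege1.
by rewrite ltW// !(mulr_gt0, invr_gt0).
Qed.

Lemma dyadic_series_bound (alpha C1 C2 : R) : 0 <= alpha -> 0 < C1 -> 0 < C2 ->
  exists2 S : R, 0 < S &
    (\sum_(0 <= j <oo) ((2 ^+ j) `^ (1 + alpha) * dyadic_weight C1 C2 j)%:E <= S%:E)%E.
Proof.
move=> alpha0 C10 C20.
have [M M0 wM] := dyadic_weight_decay alpha0 C10 C20.
exists (2 * M); first by rewrite mulr_gt0.
have partial N : \sum_(0 <= j < N) (2 ^+ j) `^ (1 + alpha) * dyadic_weight C1 C2 j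
    <= M * (2 - 2 * 2^-1 ^+ N).
  elim: N => [|N IH]; first by rewrite big_geq// expr0; lra.
  (* The partial sums of the geometric series of ratio 1/2 are 2 - 2 * 2^(-N). *)
  rewrite big_nat_recr//= exprS; have := wM N; set y := 2^-1 ^+ N in IH *.
  by move: IH; lra.
apply: lime_le.
  apply: is_cvg_nneseries => j _ _; rewrite lee_fin mulr_ge0 ?powR_ge0//.
  exact/dyadic_weight_ge0/ltW.
apply: nearW => N; rewrite sumEFin lee_fin (le_trans (partial N))//.
by rewrite mulrC ler_pM2r// gerBl mulr_ge0// exprn_ge0.
Qed.

End dyadic_series.

(** * From exponential concentration to fast rates *)

Section fast_rate.
Context (R : realType) (d n : nat) (P : probability ('rV[R]_d * bool)%type R)
  (eta : 'rV[R]_d -> R).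
Notation Z := ('rV[R]_d * bool)%type.
Context (etahat : n.-tuple Z -> 'rV[R]_d -> R).
Hypothesis etaP : regression_function P eta.
Hypothesis mhat : measurable_fun setT (fun t : n.-tuple Z * 'rV[R]_d => etahat t.1 t.2).

Definition disagreement x : set (n.-tuple Z) :=
  [set D | plug_in (etahat D) x != plug_in eta x].

Let meta := measurable_regression etaP.

Lemma measurable_hat_in_point D : measurable_fun setT (etahat D).
Proof. exact: (measurableT_comp mhat (pair1_measurable D)). Qed.

Lemma measurable_hat_in_sample x : measurable_fun setT (etahat^~ x).
Proof. exact: (measurableT_comp mhat (pair2_measurable x)). Qed.

Lemma measurable_disagreement_graph : measurable_fun setT
  (fun t : n.-tuple Z * 'rV[R]_d => plug_in (etahat t.1) t.2 != plug_in eta t.2).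
Proof.
apply: (measurable_fun_bool true); rewrite setTI.
rewrite (_ : _ @^-1` _ =
    ((fun t => plug_in (etahat t.1) t.2) @^-1` [set true] `&`
     ((plug_in eta \o snd) @^-1` [set false])) `|`
    ((fun t => plug_in (etahat t.1) t.2) @^-1` [set false] `&`
     ((plug_in eta \o snd) @^-1` [set true]))); last first.
  apply/seteqP; split => -[D x] /=.
    by case: plug_in; case: plug_in => //= _; [left|right].
  by case: plug_in; case: plug_in => //= -[] [].
have m1 : measurable_fun setT (fun t : n.-tuple Z * 'rV[R]_d => plug_in (etahat t.1) t.2).
  exact: measurable_plug_in.
have m2 : measurable_fun setT (plug_in eta \o snd : n.-tuple Z * 'rV[R]_d -> bool).
  exact: (measurableT_comp (measurable_plug_in_eta etaP) measurable_snd).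
by apply: measurableU; apply: measurableI; rewrite -[X in measurable X]setTI;
  [apply: m1|apply: m2|apply: m1|apply: m2].
Qed.

Lemma measurable_disagreement x : measurable (disagreement x).
Proof.
rewrite -[X in measurable X]setTI.
rewrite (_ : disagreement x = (fun D => plug_in (etahat D) x != plug_in eta x)
  @^-1` [set true]); last by apply/seteqP; split.
exact: (measurableT_comp measurable_disagreement_graph (pair2_measurable x)).
Qed.

Lemma measurable_disagreement_prob :
  measurable_fun setT (fun x => iid_law n P (disagreement x)).
Proof.
have mA : measurable [set t : n.-tuple Z * 'rV[R]_d |
    plug_in (etahat t.1) t.2 != plug_in eta t.2].
  rewrite -[X in measurable X]setTI.
  by apply: (measurable_disagreement_graph measurableT (Y := [set true])).
apply: eq_measurable_fun (measurable_fun_ysection (iid_law n P) mA) => x _ /=.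
by congr (iid_law n P _); apply/seteqP; split => D; rewrite /ysection/= inE.
Qed.

(** Fubini-Tonelli applied to the regret, which is nonnegative and jointly
    measurable in the sample and the point. *)
Lemma expected_risk :
  (\int[iid_law n P]_D risk P (plug_in (etahat D)) = risk P (plug_in eta) +
   \int[marginal P]_x (`|2 * eta x - 1|%:E * iid_law n P (disagreement x)))%E.
Proof.
have mreg : measurable_fun setT (fun t : n.-tuple Z * 'rV[R]_d =>
    (regret eta (plug_in (etahat t.1)) t.2)%:E).
  apply/measurable_EFinP; apply: measurable_funM.
    apply: measurableT_comp => //; apply: measurable_funB => //.
    by apply: measurable_funM => //; exact: (measurableT_comp meta measurable_snd).
  apply: (@measurableT_comp _ _ _ _ _ _ (fun b : bool => b%:R : R)) => //.
  exact: measurable_disagreement_graph.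
have reg0 t : (0 <= (regret eta (plug_in (etahat t.1)) t.2)%:E)%E.
  by rewrite lee_fin regret_ge0.
under eq_integral => D _.
  rewrite (risk_regret etaP); last exact: measurable_plug_in (measurable_hat_in_point D).
  over.
rewrite ge0_integralD//; last 2 first.
- by move=> D _; apply: integral_ge0 => x _; exact: (reg0 (D, x)).
- exact: (measurable_fun_fubini_tonelli_F _ mreg).
rewrite integral_cst// [X in (_ * X)%E](_ : _ = 1%E); last exact: probability_setT.
rewrite mule1; congr (_ + _)%E.
rewrite (@fubini_tonelli _ _ _ _ _ (iid_law n P) (marginal P)
  (fun t => (regret eta (plug_in (etahat t.1)) t.2)%:E))//.
apply: eq_integral => x _ /=.
under eq_integral do rewrite EFinM.
rewrite ge0_integralZl//; last first.
  apply/measurable_EFinP.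
  apply: (@measurableT_comp _ _ _ _ _ _ (fun b : bool => b%:R : R)) => //.
  exact: (measurableT_comp measurable_disagreement_graph (pair2_measurable x)).
congr (_ * _)%E.
rewrite -[disagreement x]setIT -integral_indic//; last exact: measurable_disagreement.
apply: eq_integral => D _; rewrite indicE /disagreement; congr ((nat_of_bool _)%:R%:E).
by apply/idP/idP => [?|/set_mem]//; exact/mem_set.
Qed.

(** The estimator and eta are on opposite sides of 1/2, so the point 1/2 lies
    between them. *)
Lemma disagreement_sub x :
  disagreement x `<=` [set D | `|eta x - 2^-1| <= `|etahat D x - eta x|].
Proof.
move=> D; rewrite /disagreement/= /plug_in.
have [a1|a1] := leP 2^-1 (etahat D x); have [a2|a2] := leP 2^-1 (eta x) => //= _.
  rewrite ltr0_norm ?subr_lt0// ger0_norm; lra.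
rewrite ger0_norm ?subr_ge0// ltr0_norm; lra.
Qed.


(** The level a of the deviation inequality is kept separate from
    |eta x - 1/2|: the inequality holds almost everywhere for each fixed level
    only, so it cannot be used at a level that varies with x. *)
Lemma disagreement_exp_bound (C a : R) x :
  (iid_law n P [set D | (a <= `|etahat D x - eta x|)%R] <= C%:E)%E ->
  a <= `|eta x - 2^-1| -> (iid_law n P (disagreement x) <= C%:E)%E.
Proof.
move=> PC a_le; apply: le_trans PC; apply: le_measure.
- by rewrite inE; exact: measurable_disagreement.
- rewrite inE -[X in measurable X]setTI.
  have mg : measurable_fun setT (fun D => `|etahat D x - eta x|).
    apply: measurableT_comp => //; apply: measurable_funB => //.
    exact: measurable_hat_in_sample.
  by apply: (measurable_fun_ler (measurable_cst a) mg measurableT (Y := [set true])).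
- by move=> D /disagreement_sub; exact: le_trans.
Qed.

Context (alpha C0 C1 C2 a dl : R).
Hypotheses (alpha0 : 0 <= alpha) (C00 : 0 < C0) (C10 : 0 < C1) (C20 : 0 < C2).
Hypotheses (dl0 : 0 < dl) (adl : a * dl ^+ 2 = 1).
Hypothesis margin_eta : margin alpha C0 P eta.
Hypothesis concentration : forall delta, 0 < delta -> {ae marginal P, forall x,
  (iid_law n P [set D | (delta <= `|etahat D x - eta x|)%R]
   <= (C1 * expR (- C2 * a * delta ^+ 2))%:E)%E}.

(** The shells are nested, from the level set eta = 1/2 (excluded) outwards,
    rather than annuli: the margin assumption bounds the mass of such sets. *)
Definition margin_shell (r : R) : set 'rV[R]_d :=
  [set x | 0 < `|eta x - 2^-1| <= r].

Definition shell_height (j : nat) : R := 2 * (2 ^+ j * dl) * dyadic_weight C1 C2 j.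

Lemma shell_height_ge0 j : 0 <= shell_height j.
Proof.
by rewrite !mulr_ge0 ?exprn_ge0 ?dyadic_weight_ge0// ltW.
Qed.

Lemma measurable_margin_shell r : measurable (margin_shell r).
Proof.
have mz : measurable_fun setT (fun x => `|eta x - 2^-1|).
  by apply: measurableT_comp => //; exact: measurable_funB.
rewrite (_ : margin_shell r = (fun x => 0 < `|eta x - 2^-1|) @^-1` [set true] `&`
  (fun x => `|eta x - 2^-1| <= r) @^-1` [set true]); last first.
  by apply/seteqP; split => x /= => [/andP[]|[h1 h2]] //; exact/andP.
apply: measurableI; rewrite -[X in measurable X]setTI.
  by apply: (measurable_fun_ltr (measurable_cst (0 : R)) mz measurableT (Y := [set true])).
by apply: (measurable_fun_ler mz (measurable_cst r) measurableT (Y := [set true])).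
Qed.

(** The term with the least j such that |eta x - 1/2| <= 2^j dl dominates the
    left-hand side on its own. *)
Lemma dyadic_shell_bound x :
  (forall j : nat, (iid_law n P [set D | (2 ^+ j * dl <= `|etahat D x - eta x|)%R]
     <= (C1 * expR (- C2 * (2 ^+ j) ^+ 2))%:E)%E) ->
  (`|2 * eta x - 1|%:E * iid_law n P (disagreement x) <=
   \sum_(0 <= j <oo) (shell_height j * \1_(margin_shell (2 ^+ j * dl)) x)%:E)%E.
Proof.
move=> Px.
have term0 j : (0 <= (shell_height j * \1_(margin_shell (2 ^+ j * dl)) x)%:E)%E.
  by rewrite lee_fin mulr_ge0 ?shell_height_ge0.
pose z := `|eta x - 2^-1|.
have zE : `|2 * eta x - 1| = 2 * z.
  by rewrite -[X in X * z](@ger0_norm _ 2)// -normrM; congr `|_|; lra.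
have [z0|z0] := eqVneq z 0.
  by rewrite zE z0 mulr0 mul0e; apply: nneseries_ge0 => j _ _.
have zp : 0 < z by rewrite lt_def z0 normr_ge0.
have exj : exists j, z <= 2 ^+ j * dl.
  exists (Num.truncn (z / dl)).+1.
  rewrite -ler_pdivrMr// (le_trans (ltW (truncnS_gt _)))//.
  by rewrite -natrX ler_nat ltnW// ltn_expl.
case: (ex_minnP exj) => j zj jmin.
apply: (@le_trans _ _ (shell_height j)%:E); last first.
  have := @nneseries_lim_ge R (fun j => (shell_height j *
    \1_(margin_shell (2 ^+ j * dl)) x)%:E) xpredT 0 j.+1 (fun i _ _ => term0 i).
  apply: le_trans; rewrite big_nat_recr//= [X in (_ + X)%E](_ : _ = (shell_height j)%:E).
    by rewrite leeDr// sume_ge0.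
  by rewrite indicE mem_set ?mulr1//= /margin_shell/= -/z zp.
have q0 : (0 <= iid_law n P (disagreement x))%E by [].
rewrite zE /shell_height [X in (_ <= X)%E]EFinM; apply: lee_pmul => //.
- by rewrite lee_fin mulr_ge0// ltW.
- by rewrite lee_fin ler_pM2l.
case: j zj jmin => [|i] zj jmin /=.
  by apply: probability_le1; exact: measurable_disagreement.
apply: disagreement_exp_bound (Px i) _.
(* Minimality of j = i + 1 puts |eta x - 1/2| above 2^i dl. *)
rewrite leNgt; apply/negP => zi.
by have := jmin _ (ltW zi); rewrite ltnn.
Qed.

(** Only the countably many levels 2^j dl are used, so the exceptional null
    sets of the concentration inequality have a null union. *)
Lemma plug_in_rate (S : R) :
  (\sum_(0 <= j <oo) ((2 ^+ j) `^ (1 + alpha) * dyadic_weight C1 C2 j)%:E <= S%:E)%E ->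
  (\int[iid_law n P]_D risk P (plug_in (etahat D)) - risk P (plug_in eta)
   <= (2 * C0 * S * dl `^ (1 + alpha))%:E)%E.
Proof.
move=> HS; rewrite expected_risk.
have Rfin : risk P (plug_in eta) \is a fin_num.
  rewrite (riskE etaP); last exact: measurable_plug_in_eta etaP.
  apply: integrable_fin_num => //.
  exact: integrable_pointwise_risk (measurable_plug_in_eta etaP).
rewrite [X in (X - _)%E]addeC addeK//.
have mterm j : measurable_fun setT
    (fun x => (shell_height j * \1_(margin_shell (2 ^+ j * dl)) x)%:E).
  apply/measurable_EFinP; apply: measurable_funM => //.
  by apply: measurable_indic; exact: measurable_margin_shell.
have term0 j x : (0 <= (shell_height j * \1_(margin_shell (2 ^+ j * dl)) x)%:E)%E.
  by rewrite lee_fin mulr_ge0 ?shell_height_ge0.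
apply: (@le_trans _ _ (\int[marginal P]_x \sum_(0 <= j <oo)
    (shell_height j * \1_(margin_shell (2 ^+ j * dl)) x)%:E)%E).
  apply: ae_ge0_le_integral => //.
  - by move=> x _; rewrite mule_ge0.
  - apply: emeasurable_funM.
      apply/measurable_EFinP; apply: measurableT_comp => //; apply: measurable_funB => //.
      by apply: measurable_funM.
    exact: measurable_disagreement_prob.
  - by move=> x _; apply: nneseries_ge0 => j _ _.
  - by apply: ge0_emeasurable_sum.
  - have : {ae marginal P, forall x, forall j : nat,
      (iid_law n P [set D | (2 ^+ j * dl <= `|etahat D x - eta x|)%R]
        <= (C1 * expR (- C2 * a * (2 ^+ j * dl) ^+ 2))%:E)%E}.
      apply: ae_foralln => j; apply: concentration.
      by rewrite mulr_gt0// exprn_gt0.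
    apply: filterS => x Hx _; apply: dyadic_shell_bound => j.
    rewrite (_ : - C2 * (2 ^+ j) ^+ 2 = - C2 * a * (2 ^+ j * dl) ^+ 2)//.
    by rewrite exprMn -(mulr1 (- C2 * _)) -adl; ring.
rewrite integral_nneseries//.
apply: (@le_trans _ _ (\sum_(0 <= j <oo) ((2 * C0 * dl `^ (1 + alpha))%:E *
    ((2 ^+ j) `^ (1 + alpha) * dyadic_weight C1 C2 j)%:E))%E).
  apply: lee_nneseries; first by move=> j _ _; exact: integral_ge0.
  move=> j _; under eq_integral do rewrite EFinM.
  rewrite ge0_integralZl//; last first.
  - by rewrite lee_fin shell_height_ge0.
  - apply/measurable_EFinP; apply: measurable_indic; exact: measurable_margin_shell.
  rewrite integral_indic//; last exact: measurable_margin_shell.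
  rewrite setIT.
  have s0 : 0 < 2 ^+ j * dl by rewrite mulr_gt0// exprn_gt0.
  apply: le_trans (lee_pmul _ _ (lexx _) (margin_eta s0)) _ => //.
    by rewrite lee_fin shell_height_ge0.
  rewrite -!EFinM lee_fin /shell_height.
  have tw : (2 ^+ j * dl) * (2 ^+ j * dl) `^ alpha =
      (2 ^+ j) `^ (1 + alpha) * dl `^ (1 + alpha).
    rewrite -powRM ?exprn_ge0 ?ltW//.
    rewrite powRD; last by rewrite (gt_eqF s0) implybT.
    by rewrite powRr1// ltW.
  rewrite le_eqVlt; apply/orP; left; apply/eqP.
  set w := dyadic_weight _ _ _.
  transitivity (2 * C0 * w * ((2 ^+ j * dl) * (2 ^+ j * dl) `^ alpha)).
    by move: (powR _ _) => u; ring.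
  by rewrite tw; move: (powR _ _) (powR _ _) => u v; ring.
rewrite nneseriesZl => [|j _]; last first.
  rewrite lee_fin mulr_ge0 ?powR_ge0// dyadic_weight_ge0//; exact: ltW.
rewrite (mulrAC _ S) [X in (_ <= X)%E]EFinM; apply: lee_pmul => //.
- by rewrite lee_fin mulr_ge0 ?powR_ge0// mulr_ge0// ltW.
- apply: nneseries_ge0 => j _ _; rewrite lee_fin mulr_ge0 ?powR_ge0//.
  exact/dyadic_weight_ge0/ltW.
Qed.

End fast_rate.

(** * The rate of the truncated plug-in classifier *)

Theorem theorem3p3 (R : realType) (alpha C0 C1 C2 : R) :
  0 <= alpha -> 0 < C0 -> 0 < C1 -> 0 < C2 ->
  exists2 C : R, 0 < C &
    forall (d : nat) (beta L c0 r0 mumin mumax : R) (Cset : set 'rV[R]_d)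
      (K : 'rV[R]_d -> R),
    (0 < d)%N -> 0 < beta -> 0 < L -> 0 < c0 -> 0 < r0 ->
    0 < mumin -> mumin < mumax -> compact Cset ->
    admissible_kernel beta K ->
    exp_concentration alpha C0 beta L c0 r0 mumin mumax Cset K C1 C2 ->
    forall n : nat, (1 <= n)%N ->
    (ereal_sup [set e | exists (P : probability ('rV[R]_d * bool)%type R) eta,
                  in_class alpha C0 beta L c0 r0 mumin mumax Cset P eta /\
                  e = excess_risk beta K n P eta]
     <= (C * n%:R `^ (- (beta * (1 + alpha) / (2 * beta + d%:R))))%:E)%E.
Proof.
move=> alpha0 C00 C10 C20.
have [S S0 HS] := dyadic_series_bound alpha0 C10 C20.
exists (2 * C0 * S); first by rewrite !mulr_gt0.
move=> d beta L c0 r0 mumin mumax Cset K _ beta0 _ _ _ _ _ _ Kadm conc n n1.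
apply: ge_ereal_sup => _ [P [eta [Peta ->]]].
have n0 : 0 < n%:R :> R by rewrite ltr0n.
set v := 2 * beta + d%:R.
pose dl : R := n%:R `^ (- (beta / v)).
have dl0 : 0 < dl by exact: powR_gt0.
have adl : n%:R `^ (2 * beta / v) * dl ^+ 2 = 1.
  rewrite -powR_mulrn ?ltW// -powRrM -powRD; last by rewrite (gt_eqF n0) implybT.
  by rewrite (_ : _ + _ = 0) ?powRr0//; ring.
have -> : n%:R `^ (- (beta * (1 + alpha) / v)) = dl `^ (1 + alpha).
  by rewrite -powRrM; congr (_ `^ _); ring.
apply: (plug_in_rate (class_regression Peta)) HS => //.
- apply: measurable_eta_star; [exact: kernel_measurable Kadm|exact: kernel_ge0 Kadm|].
  exact: powR_gt0.
- exact: adl.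
- exact: class_margin Peta.
- by move=> delta delta0; exact: conc.
Qed.
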